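(* Let $G$ be a nontrivial connected graph with maximum degree $\Delta$. Then $\delta(G)\leq \kappa^+(G)\leq rvd(G)\leq \chi_i(G)\leq \Delta(\Delta-1)+1$.
   Context: All graphs are simple, finite and undirected; a graph is nontrivial if it has at least two vertices. $\delta(G)$ is the minimum degree of $G$. Local and upper connectivity: for nonadjacent distinct vertices $x,y$, the local connectivity $\kappa_G(x,y)$ is the minimum number of vertices (other than $x,y$) whose removal separates $x$ from $y$; for adjacent $x,y$, $\kappa_G(x,y)=\kappa_{G-xy}(x,y)+1$. The upper connectivity $\kappa^+(G)$ is the maximum of $\kappa_G(x,y)$ over all pairs of distinct vertices $x,y$ of $G$. Injective chromatic number: an injective coloring of $G$ is a vertex-coloring in which any two distinct vertices with a common neighbor have different colors; $\chi_i(G)$ is the minimum number of colors in an injective coloring of $G$. Rainbow vertex-disconnection number: let $G$ be a nontrivial connected graph whose vertices are colored (adjacent vertices may receive the same color). A set $X\subseteq V(G)$ is rainbow if no two vertices of $X$ have the same color. For two distinct vertices $x,y$ of $G$: if $x,y$ are nonadjacent, an $x$-$y$ rainbow vertex-cut is a rainbow set $S\subseteq V(G)\setminus\{x,y\}$ such that $x$ and $y$ belong to different components of $G-S$; if $x,y$ are adjacent, an $x$-$y$ rainbow vertex-cut is a set $S\subseteq V(G)\setminus\{x,y\}$ such that $x$ and $y$ belong to different components of $(G-xy)-S$ and at least one of $S\cup\{x\}$, $S\cup\{y\}$ is rainbow. The coloring is a rainbow vertex-disconnection coloring if every two distinct vertices $x,y$ of $G$ have an $x$-$y$ rainbow vertex-cut.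 $rvd(G)$ is the minimum number of colors in a rainbow vertex-disconnection coloring of $G$. *)

(* Defs.v *)
From mathcomp Require Import all_boot.
Set Implicit Arguments.
Unset Strict Implicit.
Unset Printing Implicit Defensive.

(* A graph on a finite vertex type T is an adjacency relation e : rel T; that
   it is simple and undirected (irreflexive, symmetric) is assumed in theorems. *)

Section Graph.
Variable T : finType.
Implicit Types (e : rel T) (x y z : T) (S : {set T}).

Definition nbhd e x : {set T} := [set y | e x y].

Definition degree e x : nat := #|nbhd e x|.

(* The initial value #|T| is never attained on a nonempty graph, since every
   degree in an irreflexive graph is smaller than #|T|. *)
Definition min_degree e : nat := \big[minn/#|T|]_(x : T) degree e x.

Definition max_degree e : nat := \max_(x : T) degree e x.

Definition connected_graph e : Prop := forall x y, connect e x y.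

Definition del_edge e x y : rel T :=
  [rel u v | e u v && ([set u; v] != [set x; y])].

Definition del_vertices e S : rel T :=
  [rel u v | [&& u \notin S, v \notin S & e u v]].

Definition separates e x y S : bool :=
  [&& x \notin S, y \notin S & ~~ connect (del_vertices e S) x y].

(* Meaningful for x <> y with e x y false: then the default set, consisting of
   all the other vertices, does separate x from y. *)
Definition min_cut_size e x y : nat :=
  #|[arg min_(S < ~: [set x; y] | separates e x y S) #|S|]|.

Definition local_connectivity e x y : nat :=
  if e x y then (min_cut_size (del_edge e x y) x y).+1
  else min_cut_size e x y.

Definition upper_connectivity e : nat :=
  \max_(p : T * T | p.1 != p.2) local_connectivity e p.1 p.2.

Section Coloring.
Variables (k : nat) (c : {ffun T -> 'I_k}).

Definition injective_coloring e : bool :=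
  [forall x, forall y,
     (x != y) && [exists z, e x z && e y z] ==> (c x != c y)].

Definition rainbow S : bool :=
  [forall x in S, forall y in S, (x != y) ==> (c x != c y)].

Definition rainbow_vertex_cut e x y S : bool :=
  if e x y then
    separates (del_edge e x y) x y S && (rainbow (x |: S) || rainbow (y |: S))
  else separates e x y S && rainbow S.

(* rvd: rainbow vertex-disconnection *)
Definition rvd_coloring e : bool :=
  [forall x, forall y,
     (x != y) ==> [exists S : {set T}, rainbow_vertex_cut e x y S]].

End Coloring.

Lemma separates_all_others e x y :
  x != y -> ~~ e x y -> separates e x y (~: [set x; y]).
Proof.
move=> xy nexy; rewrite /separates !inE !eqxx !orbT /=.
apply/negP => /connectP [p]; elim: p => [|z p IHp] /=.
  by move=> _ yx; rewrite yx eqxx in xy.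
rewrite {1}/del_vertices /= !inE !negbK => /andP [/and3P [_ zxy exz] pz].
case/orP: zxy => /eqP zE; subst z; first by apply: IHp.
by rewrite exz in nexy.
Qed.

Lemma inj_rainbow k (c : {ffun T -> 'I_k}) S : injective c -> rainbow c S.
Proof.
move=> c_inj; apply/forall_inP => x _; apply/forall_inP => y _.
by rewrite (inj_eq c_inj); apply/implyP.
Qed.

Lemma enum_rank_ffun_inj : injective [ffun x : T => enum_rank x].
Proof. by move=> x y; rewrite !ffunE => /enum_rank_inj. Qed.

Lemma injective_coloring_exists e :
  exists k, [exists c : {ffun T -> 'I_k}, injective_coloring c e].
Proof.
exists #|T|; apply/existsP; exists [ffun x => enum_rank x].
apply/forallP => x; apply/forallP => y; apply/implyP => /andP [xy _].
by rewrite (inj_eq enum_rank_ffun_inj).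
Qed.

Lemma rvd_coloring_exists e :
  exists k, [exists c : {ffun T -> 'I_k}, rvd_coloring c e].
Proof.
exists #|T|; apply/existsP; exists [ffun x => enum_rank x].
apply/forallP => x; apply/forallP => y; apply/implyP => xy.
apply/existsP; exists (~: [set x; y]); rewrite /rainbow_vertex_cut.
rewrite !(inj_rainbow _ enum_rank_ffun_inj) /= !andbT.
case: (boolP (e x y)) => exy; last exact: separates_all_others.
by apply: separates_all_others => //; rewrite /del_edge /= eqxx andbF.
Qed.

Definition injective_chromatic_number e : nat :=
  ex_minn (injective_coloring_exists e).

Definition rvd e : nat := ex_minn (rvd_coloring_exists e).

End Graph.

(* Main.v *)
Require Import Defs.
From mathcomp Require Import all_boot.

Set Implicit Arguments.
Unset Strict Implicit.
Unset Printing Implicit Defensive.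

(** The inequality min_degree <= upper_connectivity is a theorem of Mader: some
    two adjacent vertices x, y satisfy kappa(x, y) >= delta.  The proof given
    here uses a maximum adjacency ordering of the vertices, in which each vertex
    has at least as many neighbors before it as any later vertex has among the
    same predecessors (lemma ma_order_exists).  Let y be the last vertex and x
    the last of its neighbors; then y has d(y) - 1 neighbors before x, and it
    suffices that a set S separating x from y in G - xy has at least that many
    elements (lemma separates_edge).

    Give an edge wu, with w before u, as its rank the number of neighbors of u
    before w.  The edges of rank i form the i-th forest of the Nagamochi-Ibaraki
    decomposition, and deleting the forests of rank < j leaves the ordering a
    maximum adjacency ordering.  Suppose that A, S, B partition the vertices,
    x is in A, y is in B, and xy is the only A-B edge of rank >= j.  If |S| + j
    is less than the rank of xy, then A and B both meet, before x, the component
    of x in the graph of the edges of rank >= j.  Let C be the side that enters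
    this component second.  Among the vertices of S through which C is reached,
    the earliest one, s, has no edge of rank > j to C.  So s can be moved to
    the other side while j is increased by one, and induction on |S| gives a
    contradiction (lemmas exists_detachable and crossing_edge).

    The other inequalities are direct.  A rainbow cut uses each color at most
    once, so kappa(x, y) <= rvd; in an injective coloring every neighborhood is
    rainbow, so N(x) minus y is a rainbow cut between x and y; and the graph of
    pairs with a common neighbor has maximum degree at most Delta (Delta - 1),
    so that a greedy coloring is available. *)

(** * Maximum adjacency orderings and separating sets *)

Section BackDegree.
Variables (T : finType) (e : rel T) (pos : T -> nat).
Implicit Types (t u v w x y : T) (A B S : {set T}) (j m : nat).

(** The number of neighbors of u that come before t, where u need not be t.
    It is also the rank of the edge tu when t comes before u. *)
Definition back_degree t u : nat := #|[set w | (pos w < pos t) && e w u]|.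

(** There is an edge from u to v, u comes before v, and its rank is at least
    j. *)
Definition level j u v : bool :=
  [&& e u v, pos u < pos v & j <= back_degree u v].

(** The vertices, listed by increasing pos, form a maximum adjacency ordering. *)
Definition ma_order : Prop :=
  forall t u, pos t <= pos u -> back_degree t u <= back_degree t t.

Lemma back_degree_lt w t u :
  e w u -> pos w < pos t -> back_degree w u < back_degree t u.
Proof.
move=> ewu wt; apply/proper_card/properP; split.
  by apply/subsetP => v; rewrite !inE => /andP [vw ->]; rewrite (ltn_trans vw).
by exists w; rewrite !inE ?wt ?ewu // ltnn.
Qed.

Hypothesis pos_inj : injective pos.

Lemma back_degree_inj w w' u :
  e w u -> e w' u -> back_degree w u = back_degree w' u -> w = w'.
Proof.
move=> ew ew' E; apply: pos_inj; case: (ltngtP (pos w) (pos w')) => // lt.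
  by have := back_degree_lt ew lt; rewrite E ltnn.
by have := back_degree_lt ew' lt; rewrite E ltnn.
Qed.

(** The neighbors of u before t have distinct ranks, so at most j of them are
    joined to u by an edge of rank < j. *)
Lemma exists_level_notin t u j S :
  pos t <= pos u -> j + #|S| < back_degree t u ->
  exists w, [/\ w \notin S, pos w < pos t & level j w u].
Proof.
move=> tu big.
pose N := [set w | (pos w < pos t) && e w u].
pose low := [set w in N | back_degree w u < j].
have low_le : #|low| <= j.
  have -> : #|low| = size [seq back_degree w u | w <- enum low].
    by rewrite size_map cardE.
  rewrite -[j in leqRHS](size_iota 0); apply: uniq_leq_size.
    rewrite map_inj_in_uniq ?enum_uniq // => w w'; rewrite !mem_enum !inE.
    move=> /andP [/andP [_ ew] _] /andP [/andP [_ ew'] _].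
    exact: back_degree_inj.
  move=> i /mapP [w]; rewrite mem_enum !inE => /andP [_ wj] ->.
  by rewrite mem_iota.
have : ~~ (N \subset low :|: S).
  apply: contraL big => /subset_leq_card NS; rewrite -leqNgt.
  apply: leq_trans NS _; apply: leq_trans (leq_card_setU _ _) _.
  by rewrite leq_add2r.
case/subsetPn => w; rewrite !inE => /andP [wt ew].
rewrite wt ew /= negb_or -leqNgt => /andP [jw wS].
exists w; split=> //; rewrite /level ew jw andbT /=.
exact: leq_trans wt tu.
Qed.

Hypothesis ma : ma_order.

(** If r has no backward edge of rank >= j, then no edge of rank >= j joins a
    vertex before r to r or to a later vertex. *)
Lemma level_root r w u j :
  back_degree r r <= j -> pos r <= pos u -> level j w u -> pos r <= pos w.
Proof.
move=> rj ru /and3P [ewu _ jw]; rewrite leqNgt; apply/negP => wr.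
have := leq_ltn_trans jw (back_degree_lt ewu wr).
by rewrite ltnNge (leq_trans (ma ru) rj).
Qed.

Lemma level_leq i j u v : i <= j -> level j u v -> level i u v.
Proof. by move=> ij /and3P [euv uv jv]; rewrite /level euv uv (leq_trans ij). Qed.

(** The vertex r stands for the start of a component of the graph of the edges
    of rank >= j, and b for the first vertex of B in that component.  The
    edges of rank >= j that enter this part of B from vertices before b start
    outside A and B; the earliest of their sources has no edge of rank > j with
    an end in B. *)
Lemma exists_detachable A B r b j :
  back_degree r r <= j ->
  b \in B -> pos r <= pos b -> j < back_degree b b ->
  (forall u, u \in B -> pos r <= pos u -> pos b <= pos u) ->
  (forall u v, u \in A -> v \in B -> pos u < pos b -> ~~ level j u v) ->
  exists2 s, s \notin A :|: B &
    forall v, v \in B -> ~~ level j.+1 s v /\ ~~ level j.+1 v s.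
Proof.
move=> rj bB rb jb bmin noAB.
have notAB w v : v \in B -> pos r <= pos v -> level j w v -> pos w < pos b ->
    w \notin A :|: B.
  move=> vB rv lwv wb; rewrite inE negb_or; apply/andP; split.
    by apply/negP => wA; have := noAB _ _ wA vB wb; rewrite lwv.
  by apply/negP => /bmin /(_ (level_root rj rv lwv)); rewrite leqNgt wb.
(* P s: an edge of rank >= j leads from s, which is before b, into B. *)
pose P s := [exists v in B, (pos r <= pos v) && level j s v] && (pos s < pos b).
have [s0 Ps0] : exists s0, P s0.
  have jb0 : j + #|set0 : {set T}| < back_degree b b by rewrite cards0 addn0.
  have [w [_ wb lw]] := exists_level_notin (leqnn _) jb0.
  by exists w; rewrite /P wb andbT; apply/exists_inP; exists b; rewrite ?rb.
case: (arg_minnP pos Ps0) => s /andP [/exists_inP [v0 v0B /andP [rv0 lsv0]] sb] smin.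
have rs : pos r <= pos s := level_root rj rv0 lsv0.
exists s; first exact: notAB lsv0 sb.
move=> v vB; split; apply/negP.
  (* An edge sv of rank > j yields an edge wv of rank >= j with w before s,
     against the minimality of s. *)
  move=> lsv; have /and3P [esv sv jsv] := lsv.
  have rv : pos r <= pos v by apply: leq_trans rs (ltnW sv).
  have jsv0 : j + #|set0 : {set T}| < back_degree s v by rewrite cards0 addn0.
  have [w [_ ws lw]] := exists_level_notin (ltnW sv) jsv0.
  suff /smin : P w by rewrite leqNgt ws.
  by rewrite /P (ltn_trans ws sb) andbT; apply/exists_inP; exists v; rewrite ?rv.
move=> lvs; have /and3P [_ vs _] := lvs.
have rv := level_root rj rs (level_leq (leqnSn j) lvs).
by have := bmin _ vB rv; rewrite leqNgt (ltn_trans vs sb).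
Qed.

(** The separating set S is the complement of A :|: B.  By induction on its
    size, the edge xy is not the only edge of rank >= j between A and B. *)
Lemma crossing_edge A B x y j :
  [disjoint A & B] -> x \in A -> y \in B -> pos x < pos y ->
  j + #|~: (A :|: B)| < back_degree x y ->
  exists u v, [/\ u \in A, v \in B, level j u v || level j v u
                & (u, v) != (x, y)].
Proof.
have [n] := ubnP #|~: (A :|: B)|; elim: n => // n IHn in A B j *.
set S := ~: _ => Sn disj xA yB xy big.
have AB u : u \in A -> u \in B -> False.
  by move=> uA uB; rewrite (disjointFr disj uA) in uB.
case: (boolP [exists u in A, exists v in B,
    (level j u v || level j v u) && ((u, v) != (x, y))]) => [|none].
  case/exists_inP => u uA /exists_inP [v vB /andP [luv ne]].
  by exists u, v.
have noAB u v : u \in A -> v \in B -> level j u v || level j v u ->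
    u = x /\ v = y.
  move=> uA vB luv; suff /eqP [-> ->] : (u, v) == (x, y) by [].
  apply: contraNT none => ne.
  by apply/exists_inP; exists u => //; apply/exists_inP; exists v; rewrite ?luv.
have [wB [wBS wBx lwB]] := exists_level_notin (ltnW xy) big.
have [wA [wAS wAx lwA]] := exists_level_notin (leqnn _)
  (leq_trans big (ma (ltnW xy))).
have {wBS} wBB : wB \in B.
  move: wBS; rewrite !inE negbK => /orP [] // wBA.
  have [|E _] := noAB _ _ wBA yB; first by rewrite lwB.
  by rewrite E ltnn in wBx.
have {wAS} wAA : wA \in A.
  move: wAS; rewrite !inE negbK => /orP [] // wAB.
  have [|_ E] := noAB _ _ xA wAB; first by rewrite lwA orbT.
  by move: wAx; rewrite E ltnNge ltnW.
(* r is the last vertex up to x with no backward edge of rank >= j; the vertices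
   after it, up to x, have such an edge. *)
have [r /andP [rx rj] rmax] :
    exists2 r, (pos r <= pos x) && (back_degree r r <= j) &
      forall t, pos t <= pos x -> back_degree t t <= j -> pos t <= pos r.
  (* The first vertex of the ordering is a candidate. *)
  have [f _ fmin] := @arg_minnP _ x xpredT pos isT.
  have Pf : (pos f <= pos x) && (back_degree f f <= j).
    rewrite fmin //= /back_degree (_ : [set _ | _] = set0) ?cards0 //.
    by apply/setP => w; rewrite !inE ltnNge fmin.
  case: (@arg_maxnP _ f (fun t => (pos t <= pos x) && (back_degree t t <= j))
    pos Pf) => r Pr rmax; exists r => // t tx tj.
  by apply: rmax; rewrite tx.
have ry := leq_trans rx (ltnW xy).
have rwA := level_root rj rx lwA; have rwB := level_root rj ry lwB.
have first (C : {set T}) w : w \in C -> pos r <= pos w -> pos w < pos x ->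
    exists c, [/\ c \in C, pos r <= pos c, pos c < pos x &
      forall u, u \in C -> pos r <= pos u -> pos c <= pos u].
  move=> wC rw wx.
  case: (@arg_minnP _ w (fun u => (u \in C) && (pos r <= pos u)) pos) => [|c].
    by rewrite wC.
  move=> /andP [cC rc] cmin; exists c; split=> //.
    by apply: leq_ltn_trans wx; apply: cmin; rewrite wC.
  by move=> u uC ru; apply: cmin; rewrite uC.
have [a [aA ra ax amin]] := first _ _ wAA rwA wAx.
have [b [bB rb bx bmin]] := first _ _ wBB rwB wBx.
have deep c : pos r < pos c -> pos c < pos x -> j < back_degree c c.
  move=> rc cx; rewrite ltnNge; apply/negP => /(rmax _ (ltnW cx)).
  by rewrite leqNgt rc.
have shrink s : s \notin A :|: B -> #|S :\ s|.+1 = #|S|.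
  by move=> sAB; rewrite [in RHS](cardsD1 s) in_setC sAB.
(* The side entered second keeps its vertices; s joins the other one. *)
case: (ltngtP (pos a) (pos b)) => [ab|ba|/pos_inj E].
- have [|s sAB sB] := @exists_detachable A B r b j rj bB rb
      (deep _ (leq_ltn_trans ra ab) bx) bmin.
    move=> u v uA vB ub; apply/negP => luv.
    have [|E _] := noAB _ _ uA vB; first by rewrite luv.
    by have := ltn_trans ub bx; rewrite E ltnn.
  have [sA sB'] : s \notin A /\ s \notin B.
    by move: sAB; rewrite inE negb_or => /andP.
  have S' : ~: (s |: A :|: B) = S :\ s.
    by apply/setP => w; rewrite !inE -orbA negb_or.
  have sS := shrink _ sAB.
  have [||||||u [v [uA vB luv ne]]] := IHn (s |: A) B j.+1; rewrite ?S' //.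
  + by rewrite sS.
  + by rewrite -setI_eq0 setIUl setU_eq0 !setI_eq0 disjoints1 sB'.
  + by rewrite inE xA orbT.
  + by rewrite addSnnS sS.
  exists u, v; move: uA luv; rewrite in_setU1 => /orP [/eqP ->|uA luv].
    by have [/negPf -> /negPf ->] := sB v vB.
  by split=> //; case/orP: luv => /(level_leq (leqnSn j)) ->; rewrite ?orbT.
- have [|s sAB sA] := @exists_detachable B A r a j rj aA ra
      (deep _ (leq_ltn_trans rb ba) ax) amin.
    move=> u v uB vA ua; apply/negP => luv.
    have [|_ E] := noAB _ _ vA uB; first by rewrite luv orbT.
    by have := ltn_trans (ltn_trans ua ax) xy; rewrite E ltnn.
  rewrite setUC in sAB.
  have [sA' sB] : s \notin A /\ s \notin B.
    by move: sAB; rewrite inE negb_or => /andP.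
  have S' : ~: (A :|: (s |: B)) = S :\ s.
    by apply/setP => w; rewrite !inE orbCA negb_or.
  have sS := shrink _ sAB.
  have [||||||u [v [uA vB luv ne]]] := IHn A (s |: B) j.+1; rewrite ?S' //.
  + by rewrite sS.
  + by rewrite -setI_eq0 setIUr setU_eq0 !setI_eq0 disj andbT disjoint_sym
               disjoints1 sA'.
  + by rewrite inE yB orbT.
  + by rewrite addSnnS sS.
  exists u, v; move: vB luv; rewrite in_setU1 => /orP [/eqP ->|vB luv].
    by have [/negPf -> /negPf ->] := sA u uA.
  by split=> //; case/orP: luv => /(level_leq (leqnSn j)) ->; rewrite ?orbT.
- by rewrite -E in bB; case: (AB a).
Qed.

End BackDegree.

Lemma ma_order_exists (T : finType) (e : rel T) :
  exists2 pos : T -> nat, injective pos & ma_order e pos.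
Proof.
(* Position in a duplicate-free list s; a vertex that is not yet listed has
   position size s, hence comes after the listed ones. *)
suff [s [us ss mas]] : exists s : seq T, [/\ uniq s, size s = #|T| &
    forall t u, t \in s -> index t s <= index u s ->
      back_degree e (index^~ s) t u <= back_degree e (index^~ s) t t].
  have sT t : t \in s.
    by have [_ ->] := uniq_min_size us (fun x _ => mem_enum T x)
      (eq_leq (etrans (esym (cardE T)) (esym ss))); rewrite ?mem_enum.
  exists (index^~ s) => [x y|t u]; last exact: mas.
  by move=> E; rewrite -[x](nth_index x (sT x)) E nth_index.
elim: {1 3}#|T| (leqnn #|T|) => [_|k IHk kT]; first by exists [::].
have [s [us ss mas]] := IHk (ltnW kT).
have [x0 x0s] : exists x0, x0 \notin s.
  apply/existsP; apply: contraLR kT; rewrite negb_exists => /forallP all_s.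
  rewrite -leqNgt -ss cardE; apply: uniq_leq_size (enum_uniq _) _ => x _.
  by rewrite -[_ \in _]negbK.
pose F u := #|[set w | (index w s < size s) && e w u]|.
case: (@arg_maxnP _ x0 (fun u => u \notin s) F x0s) => z zs zmax.
have idx_lt u i : i <= size s ->
    [set w | (index w (rcons s z) < i) && e w u] =
    [set w | (index w s < i) && e w u].
  move=> si; apply/setP => w; rewrite !inE -cats1 index_cat.
  case: ifP => // /negbT ws.
  by rewrite (memNindex ws) !ltnNge si (leq_trans si) // leq_addr.
have idx_z : index z (rcons s z) = size s.
  by rewrite -cats1 index_cat (negPf zs) /= eqxx addn0.
exists (rcons s z); rewrite rcons_uniq zs us size_rcons ss; split=> // t u.
rewrite /back_degree mem_rcons in_cons => /orP [/eqP ->|ts].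
  rewrite idx_z !idx_lt // => zu; apply: zmax; apply: contraL zu => us'.
  by rewrite -ltnNge -cats1 index_cat us' index_mem.
have tz : index t (rcons s z) = index t s by rewrite -cats1 index_cat ts.
rewrite tz !idx_lt ?index_size // => tu; apply: mas ts _.
move: tu; rewrite -cats1 index_cat; case: ifP => // /negbT us' _.
by rewrite (memNindex us') index_size.
Qed.

(** * Minimum degree and upper connectivity *)

Section Cuts.
Variables (T : finType) (r : rel T).

Lemma separates_min_cut x y : x != y -> ~~ r x y ->
  exists2 S, separates r x y S & #|S| = min_cut_size r x y.
Proof.
move=> xy nrxy; rewrite /min_cut_size.
by case: arg_minnP => [|S sepS _]; [exact: separates_all_others | exists S].
Qed.

Lemma min_cut_size_le x y S : x != y -> ~~ r x y -> separates r x y S ->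
  min_cut_size r x y <= #|S|.
Proof.
move=> xy nrxy sepS; rewrite /min_cut_size.
by case: arg_minnP => [|S0 _]; [exact: separates_all_others | apply].
Qed.

End Cuts.

Section Bounds.
Variables (T : finType) (e : rel T).
Hypotheses (e_irr : irreflexive e) (e_sym : symmetric e).

Lemma min_degree_le x : min_degree e <= degree e x.
Proof.
rewrite /min_degree; elim: index_enum (mem_index_enum x) => //= y s IHs.
rewrite in_cons big_cons geq_min => /orP [/eqP ->|/IHs ->]; first by rewrite leqnn.
by rewrite orbT.
Qed.

Lemma not_del_edge x y : ~~ del_edge e x y x y.
Proof. by rewrite /del_edge /= eqxx andbF. Qed.

(** The lemma crossing_edge at j = 0, for A the component of x. *)
Lemma separates_edge x y S pos :
  injective pos -> ma_order e pos -> pos x < pos y -> 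
  separates (del_edge e x y) x y S -> back_degree e pos x y <= #|S|.
Proof.
move=> pos_inj ma xy /and3P [xS yS ncon]; rewrite leqNgt; apply/negP => big.
(* Subtracting S only makes the disjointness of A and S evident. *)
pose A := [set u | connect (del_vertices (del_edge e x y) S) x u] :\: S.
have xA : x \in A by rewrite !inE xS connect0.
have yA : y \notin A by rewrite !inE negb_and ncon orbT.
have SE : ~: (A :|: (~: A :\: S)) = S.
  by apply/setP => w; rewrite !inE; case: (w \in S); case: (connect _ _ _).
have [|||u [v [uA vB luv ne]]] :=
  @crossing_edge _ e pos pos_inj ma A (~: A :\: S) x y 0 _ xA _ xy.
- by rewrite -setI_eq0 setIDA setICr set0D.
- by rewrite in_setD yS in_setC.
- by rewrite SE.
have {luv} euv : e u v by case/orP: luv => /and3P []; rewrite // e_sym.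
move: vB; rewrite in_setD in_setC => /andP [vS vA].
have [uS cu] : u \notin S /\ connect (del_vertices (del_edge e x y) S) x u.
  by move: uA; rewrite !inE => /andP.
suff : v \in A by rewrite (negPf vA).
rewrite !inE vS; apply: connect_trans cu (connect1 _).
rewrite /del_vertices /del_edge /= uS vS euv /=; apply: contraNneq ne => /setP E.
have ux : u == x.
  have := E u; rewrite !inE eqxx /= => /esym /orP [] // /eqP uy.
  by rewrite uy (negPf yA) in uA.
have := E v; rewrite !inE eqxx orbT => /esym /orP [] /eqP vE.
  by rewrite vE xA in vA.
by rewrite (eqP ux) vE.
Qed.

(** The witnesses are the last vertex y of a maximum adjacency ordering and the
    last neighbor x of y. *)
Lemma min_degree_le_upper_connectivity :
  min_degree e <= upper_connectivity e.
Proof.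
case: (posnP (min_degree e)) => [-> //|d_gt0].
have [pos pos_inj ma] := ma_order_exists e.
have [z0|T0] := pickP (pred_of_simpl (@predT T)); last first.
  have T_eq0 : #|T| = 0 by apply: eq_card0.
  by move: d_gt0; rewrite /min_degree big_pred0 // T_eq0.
move=> _; case: (@arg_maxnP _ z0 xpredT pos isT) => y _ ymax.
have [x0 x0y] : exists x0, e y x0.
  have /card_gt0P [x0] := leq_trans d_gt0 (min_degree_le y).
  by rewrite inE => ?; exists x0.
case: (@arg_maxnP _ x0 (e y) pos x0y) => x eyx xmax.
have xy : x != y by apply: contraTneq eyx => ->; rewrite e_irr.
have pxy : pos x < pos y by rewrite ltn_neqAle (inj_eq pos_inj) xy; apply: ymax.
have bd : (back_degree e pos x y).+1 = degree e y.
  rewrite /degree (cardsD1 x) inE eyx; congr _.+1; apply: eq_card => w.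
  rewrite !inE [e w y]e_sym; case: (boolP (e y w)) => [eyw|]; rewrite ?andbF //.
  have wx : pos w <= pos x by apply: xmax.
  by rewrite !andbT ltn_neqAle (inj_eq pos_inj) wx andbT.
apply: leq_trans (min_degree_le y) _; rewrite -bd.
have /(leq_trans _) : local_connectivity e x y <= upper_connectivity e.
  by rewrite /upper_connectivity (bigD1 (x, y)) //= leq_maxl.
apply.
rewrite /local_connectivity /= e_sym eyx ltnS.
have [S sepS <-] := separates_min_cut xy (not_del_edge x y).
exact: separates_edge sepS.
Qed.

(** * Rainbow cuts and injective colorings *)

Section Colorings.
Variables (k : nat) (c : {ffun T -> 'I_k}).
Implicit Types (x y : T) (S : {set T}).

Lemma rainbowP S : reflect {in S &, injective c} (rainbow c S).
Proof.
apply: (iffP forall_inP) => [rS x y xS yS cxy|c_inj x xS].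
  have /forall_inP /(_ y yS) := rS x xS.
  by rewrite cxy eqxx implybF negbK => /eqP.
apply/forall_inP => y yS; apply/implyP; apply: contraNneq.
by move/(c_inj _ _ xS yS) => ->.
Qed.

Lemma rainbow_card S : rainbow c S -> #|S| <= k.
Proof.
move/rainbowP => c_inj; rewrite -(card_in_imset c_inj).
by apply: leq_trans (max_card _) _; rewrite card_ord.
Qed.

Lemma local_connectivity_le_colors x y :
  rvd_coloring c e -> x != y -> local_connectivity e x y <= k.
Proof.
move=> /forallP /(_ x) /forallP /(_ y) /implyP rvdc xy.
have /existsP [S] := rvdc xy.
rewrite /rainbow_vertex_cut /local_connectivity; case: ifP => [exy|/negbT nexy].
  move=> /andP [sepS rS]; have /and3P [xS yS _] := sepS.
  (* Adding x or y to the cut accounts for the + 1 of the adjacent case. *)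
  apply: leq_ltn_trans (min_cut_size_le xy (not_del_edge x y) sepS) _.
  by case/orP: rS => /rainbow_card; rewrite cardsU1 ?xS ?yS.
move=> /andP [sepS rS].
exact: leq_trans (min_cut_size_le xy nexy sepS) (rainbow_card rS).
Qed.

Lemma injective_coloring_nbhd x : injective_coloring c e -> rainbow c (nbhd e x).
Proof.
move=> /forallP ic; apply/rainbowP => u v; rewrite !inE => xu xv cuv.
have /forallP /(_ v) /implyP uv := ic u.
apply/eqP; apply: contraLR (eqxx (c u)) => neq; rewrite [X in _ == X]cuv.
by apply: uv; rewrite neq; apply/existsP; exists x; rewrite !(e_sym _ x) xu.
Qed.

Lemma connect_isolated (r : rel T) x y :
  x != y -> (forall z, ~~ r x z) -> ~~ connect r x y.
Proof.
move=> xy iso; apply/negP => /connectP [[|z p] /= ]; last by rewrite (negPf (iso z)).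
by move=> _ yx; rewrite yx eqxx in xy.
Qed.

(** The neighbors of x other than y form a rainbow cut between x and y; when x
    and y are adjacent, adding y gives the whole neighborhood of x. *)
Lemma injective_coloring_rvd : injective_coloring c e -> rvd_coloring c e.
Proof.
move=> ic; apply/forallP => x; apply/forallP => y; apply/implyP => xy.
apply/existsP; exists (nbhd e x :\ y); have rx := injective_coloring_nbhd x ic.
have xS : x \notin nbhd e x :\ y by rewrite !inE e_irr andbF.
rewrite /rainbow_vertex_cut /separates; case: ifP => exy.
  have yx : y \in nbhd e x by rewrite inE.
  rewrite (setD1K yx) rx orbT xS setD11 /= andbT.
  apply: connect_isolated => // z; rewrite /del_vertices /del_edge /= !inE.
  by case: (eqVneq z y) => [->|_]; case: (e x z); rewrite ?eqxx ?andbF.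
have -> : nbhd e x :\ y = nbhd e x.
  by apply/setP => z; rewrite !inE; case: eqP => // ->; rewrite exy.
rewrite rx !inE e_irr exy /= andbT; apply: connect_isolated => // z.
by rewrite /del_vertices /= !inE; case: (e x z); rewrite ?andbF.
Qed.

End Colorings.

Lemma upper_connectivity_le_rvd : upper_connectivity e <= rvd e.
Proof.
rewrite /rvd; case: ex_minnP => k /existsP [c rvdc] _.
by apply/bigmax_leqP => p; apply: (local_connectivity_le_colors (c := c)).
Qed.

Lemma rvd_le_injective_chromatic_number : rvd e <= injective_chromatic_number e.
Proof.
rewrite /injective_chromatic_number; case: ex_minnP => k /existsP [c ic] _.
rewrite /rvd; case: ex_minnP => m _; apply.
by apply/existsP; exists c; apply: injective_coloring_rvd.
Qed.

End Bounds.

(** * Greedy coloring of the common-neighbor graph *)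

Lemma greedy_coloring (T : finType) (h : rel T) D :
  irreflexive h -> symmetric h -> (forall x, degree h x <= D) ->
  exists c : {ffun T -> 'I_D.+1}, forall x y, h x y -> c x != c y.
Proof.
move=> h_irr h_sym hD.
suff [c cP] : exists c : {ffun T -> 'I_D.+1},
    forall x y, x \in enum T -> y \in enum T -> h x y -> c x != c y.
  by exists c => x y; apply: cP; rewrite mem_enum.
elim: (enum T) => [|x s [c cP]]; first by exists [ffun=> ord0].
have [a aN] : exists a, a \notin c @: nbhd h x.
  apply/existsP; rewrite -negb_forall; apply/negP => /forallP all_in.
  have := leq_trans (leq_imset_card c (nbhd h x)) (hD x).
  by rewrite (eq_card (B := 'I_D.+1)) ?card_ord ?ltnn // => a; rewrite all_in.
have ca u : h x u -> c u != a.
  by move=> xu; apply: contraNneq aN => <-; apply: imset_f; rewrite inE.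
exists [ffun u => if u == x then a else c u] => u v; rewrite !in_cons !ffunE.
case: (eqVneq u x) => [->|ux]; case: (eqVneq v x) => [->|vx] //= us vs.
- by rewrite h_irr.
- by move=> /ca; rewrite eq_sym.
- by rewrite h_sym => /ca.
exact: cP.
Qed.

Lemma card_bigcup_le (I T : finType) (P : pred I) (F : I -> {set T}) :
  #|\bigcup_(i | P i) F i| <= \sum_(i | P i) #|F i|.
Proof.
elim/big_rec2: _ => [|i n A _ An]; first by rewrite cards0.
by apply: leq_trans (leq_card_setU _ _) _; rewrite leq_add2l.
Qed.

Lemma injective_chromatic_number_le (T : finType) (e : rel T) :
  symmetric e ->
  injective_chromatic_number e <= max_degree e * (max_degree e - 1) + 1.
Proof.
move=> e_sym; set D := max_degree e.
have degD x : degree e x <= D by apply: leq_bigmax.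
(* The graph of pairs of vertices with a common neighbor. *)
pose h : rel T := [rel x y | (x != y) && [exists z, e x z && e y z]].
have hD x : degree h x <= D * (D - 1).
  have sub : nbhd h x \subset \bigcup_(z in nbhd e x) (nbhd e z :\ x).
    apply/subsetP => y; rewrite inE => /andP [xy /existsP [z /andP [xz yz]]].
    by apply/bigcupP; exists z; rewrite !inE ?xz // eq_sym xy e_sym.
  apply: leq_trans (subset_leq_card sub) _.
  apply: leq_trans (card_bigcup_le _ _) _.
  apply: (@leq_trans (\sum_(z in nbhd e x) (D - 1))).
    apply: leq_sum => z; rewrite inE e_sym => zx.
    have := degD z; rewrite /degree (cardsD1 x) inE zx.
    by case: (D) => // n; rewrite subn1.
  by rewrite sum_nat_const leq_mul2r degD orbT.
have [||c cP] := greedy_coloring _ _ hD.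
- by move=> x; rewrite /h /= eqxx.
- move=> x y; rewrite /h /= eq_sym; congr (_ && _).
  by apply: eq_existsb => z; rewrite andbC.
rewrite addn1 /injective_chromatic_number; case: ex_minnP => k _; apply.
apply/existsP; exists c; apply/forallP => x; apply/forallP => y.
by apply/implyP; apply: cP.
Qed.

Theorem theorem2p7 (T : finType) (e : rel T)
    (e_irr : irreflexive e) (e_sym : symmetric e)
    (nontrivial : 1 < #|T|) (e_conn : connected_graph e) :
  [/\ min_degree e <= upper_connectivity e,
      upper_connectivity e <= rvd e,
      rvd e <= injective_chromatic_number e
    & injective_chromatic_number e
        <= max_degree e * (max_degree e - 1) + 1].
Proof.
split.
- exact: min_degree_le_upper_connectivity.
- exact: upper_connectivity_le_rvd.
- exact: rvd_le_injective_chromatic_number.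
- exact: injective_chromatic_number_le.
Qed.
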